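(* Let $(P,\le)$ be a finite connected poset, let $\pi\in\Pi_P$ be a maximal chain (path) of $P$, and let $a_1\neq a_2$ be two extreme vectors of $\mathcal{C}(\pi)$, i.e. $a_1,a_2\in\mathscr{ER}(\pi)$. Then $a_1$ and $a_2$ form a two-dimensional face of the cone $\mathcal{C}(\pi)$ if and only if their order graph $\mathcal{G}(a_1,a_2)$ is connected.
   Context: $P$ is connected means that its Hasse diagram is connected as a graph. $\Pi_P$ denotes the set of maximal chains of $P$, called paths. A path $\pi$ is identified with its indicator vector in $\mathbb{R}^P$, and $\langle\cdot,\cdot\rangle$ is the standard inner product on $\mathbb{R}^P$. With $\mathbb{R}_+=[0,\infty)$, for $\pi\in\Pi_P$, $$\mathcal{C}(\pi)=\{\omega\in\mathbb{R}_+^P:\langle\omega,\pi\rangle\ge\langle\omega,\pi'\rangle\text{ for all }\pi'\in\Pi_P\}.$$ $\mathscr{ER}(\pi)$ is the set of extreme rays of the polyhedral cone $\mathcal{C}(\pi)$, each represented canonically by its generator with entries in $\{0,1\}$; these generators are exactly the indicator vectors $a(\mathbf{v})=\mathbf{1}\{\mathbf{v}\in A\}$ of antichains $A\subset P$ containing exactly one element of $\pi$. For $\omega\in\mathbb{R}^P$, $\operatorname{supp}(\omega)=\{\mathbf{v}\in P:\omega(\mathbf{v})\ne 0\}$. Perturbation space: for $\omega\in\mathcal{C}(\pi)$, $$\mathcal{D}_\pi(\omega)=\{\sigma\in\mathbb{R}^P:\exists\,\epsilon>0\text{ such that }\omega\pm\epsilon\sigma\in\mathcal{C}(\pi)\}.$$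 Two distinct $a_1,a_2\in\mathscr{ER}(\pi)$ form a two-dimensional face of $\mathcal{C}(\pi)$ means that $\mathcal{D}_\pi(a_1+a_2)=\operatorname{Span}\{a_1,a_2\}$. Order graph: $\mathcal{G}(a_1,a_2)$ is the bipartite graph with one part $\operatorname{supp}(a_1)\setminus\operatorname{supp}(a_2)$, the other part $\operatorname{supp}(a_2)\setminus\operatorname{supp}(a_1)$, and an edge between two vertices if they are in order (comparable in $P$). (One of the parts may be empty.) *)

(* Defs.v *)
From mathcomp Require Import all_boot all_order all_algebra.
From mathcomp Require Import reals.

Set Implicit Arguments.
Unset Strict Implicit.
Unset Printing Implicit Defensive.

Import Order.TTheory GRing.Theory Num.Theory.
Local Open Scope ring_scope.

(* The graph with vertex set V whose edges are the pairs of vertices related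
   by e is connected. The empty graph counts as connected. *)
Definition graph_connected (T : finType) (V : {set T}) (e : rel T) : Prop :=
  forall x y : T, x \in V -> y \in V ->
    connect [rel u v | [&& u \in V, v \in V & e u v]] x y.

Section PosetPaths.
Context {d : Order.disp_t} (P : finPOrderType d).

Definition covers (x y : P) : bool :=
  (x < y)%O && [forall z : P, ~~ ((x < z)%O && (z < y)%O)].

Definition hasse : rel P := [rel x y | covers x y || covers y x].

Definition poset_connected : Prop := graph_connected [set: P] hasse.

Definition is_chain (A : {set P}) : bool :=
  [forall x in A, forall y in A, (x >=< y)%O].

Definition paths : {set {set P}} := [set A | maxset is_chain A].

End PosetPaths.

Section Cone.
Context {R : realType} {d : Order.disp_t} {P : finPOrderType d}.
(* R^P; the regular module R^o makes it a finite-dimensional vector space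
   over R, so that the spans of vector.v are available. *)
Local Notation V := {ffun P -> R^o}.
Implicit Types (w s a x y : V) (pi : {set P}).

Definition indicator (A : {set P}) : V := [ffun v => (v \in A)%:R].

Definition inner w x : R := \sum_(v : P) (w v : R) * (x v : R).

Definition cone pi w : Prop :=
  (forall v : P, 0 <= (w v : R)) /\
  (forall pi' : {set P}, pi' \in paths P ->
     inner w (indicator pi') <= inner w (indicator pi)).

Definition ray a x : Prop := exists2 t : R, 0 <= t & x = t *: a.

(* The ray generated by a is a one-dimensional face of the convex cone C. *)
Definition generates_extreme_ray (C : V -> Prop) a : Prop :=
  [/\ C a, a != 0 &
      forall x y, C x -> C y -> ray a (x + y) -> ray a x /\ ray a y].

(* Extreme rays of the cone, represented by their 0/1 generators. *)
Definition ER pi a : Prop :=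
  generates_extreme_ray (cone pi) a /\
  (forall v : P, a v = 0 \/ a v = 1).

Definition supp w : {set P} := [set v | w v != 0].

Definition perturbation pi w s : Prop :=
  exists eps : R, [/\ 0 < eps, cone pi (w + eps *: s) & cone pi (w - eps *: s)].

Definition form_2face pi a1 a2 : Prop :=
  forall s : V, perturbation pi (a1 + a2) s <-> s \in <<[:: a1; a2]>>%VS.

Definition order_graph_vertices a1 a2 : {set P} :=
  (supp a1 :\: supp a2) :|: (supp a2 :\: supp a1).

Definition order_graph_edge a1 a2 : rel P :=
  [rel u v | (u >=< v)%O &&
     ((u \in supp a1 :\: supp a2) && (v \in supp a2 :\: supp a1) ||
      (u \in supp a2 :\: supp a1) && (v \in supp a1 :\: supp a2))].

Definition order_graph_connected a1 a2 : Prop :=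
  graph_connected (order_graph_vertices a1 a2) (order_graph_edge a1 a2).

End Cone.

(* Main.v *)
Require Import Defs.
From mathcomp Require Import all_boot all_order all_algebra.
From mathcomp Require Import reals.
Import Order.TTheory GRing.Theory Num.Theory.
Local Open Scope ring_scope.

(** The two extreme vectors are indicators of antichains [A] and [B], each
    meeting the path [pi] (in exactly one point, since a chain and an antichain
    share at most one): [ER_antichain].  A path is then tight for
    [ind A + ind B], that is, as heavy as [pi], exactly when it meets both
    antichains.

    If the order graph is connected, take a perturbation [s] of
    [ind A + ind B].  It vanishes off [A :|: B] and has the same sum [c] on all
    tight paths.  A comparable pair [u] in [A], [v] in [B] lies on a tight path
    and is all that [s] sees of it, so [s u + s v = c] when [u] and [v] differ,
    and [s u = c] when they coincide ([perturbation_pair]).  Hence [s] takes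
    one value [t] on the [A]-side of the graph and [c - t] on the [B]-side, and
    it is [c] on [A :&: B]: it equals [t *: ind A + (c - t) *: ind B]
    ([connected_span]).  Conversely every vector of the span is a perturbation,
    because a small step along it leaves nonnegative coefficients on [ind A]
    and [ind B] ([span_perturbation]).

    If the order graph is disconnected, let [K] be one of its components.
    Exchanging the roles of [A] and [B] on [K] produces two new antichains
    [swap A B K] and [swap B A K] that still meet [pi], and whose indicators
    have the same sum as those of [A] and [B].  So [ind (swap A B K) - ind A]
    is a perturbation ([swap_perturbation]).  It is outside the span, because
    its coefficients there would have to take one value at the vertices in [K]
    and another at the remaining vertices ([connected_of_2face]). *)

Set Implicit Arguments.
Unset Strict Implicit.
Unset Printing Implicit Defensive.

(** * Chains and antichains *)

Section Chains.
Context {d : Order.disp_t} {P : finPOrderType d}.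
Implicit Types (A B C K pi : {set P}) (p q u v x y z : P).

Definition antichain A : Prop := {in A &, forall x y, (x >=< y)%O -> x = y}.

Definition minimals A : {set P} :=
  [set x in A | [forall y in A, ~~ (y < x)%O]].

Lemma is_chainP C : reflect {in C &, forall x y, (x >=< y)%O} (is_chain C).
Proof.
apply: (iffP forall_inP) => h x.
  by move=> y xC yC; have /forall_inP/(_ y yC) := h x xC.
by move=> xC; apply/forall_inP => y yC; exact: h.
Qed.

Lemma path_chain pi : pi \in paths P -> is_chain pi.
Proof. by rewrite inE => /maxsetp. Qed.

Lemma sub_chain B C : B \subset C -> is_chain C -> is_chain B.
Proof.
move=> /subsetP BC /is_chainP hC; apply/is_chainP => x y xB yB.
by apply: hC; exact: BC.
Qed.

Lemma chain_sub_path C :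
  is_chain C -> exists2 pi, pi \in paths P & C \subset pi.
Proof. by move=> /maxset_exists [pi pi_max Cpi]; exists pi; rewrite ?inE. Qed.

Lemma is_chain2 u v : (u >=< v)%O -> is_chain [set u; v].
Proof.
move=> uv; apply/is_chainP => x y; rewrite !inE.
by move=> /orP[] /eqP-> /orP[] /eqP->; rewrite ?comparablexx // comparable_sym.
Qed.

Lemma antichain_chain A C v : antichain A -> is_chain C -> v \in A -> v \in C ->
  A :&: C = [set v].
Proof.
move=> hA /is_chainP hC vA vC; apply/setP => x; rewrite !inE.
apply/andP/eqP => [[xA xC]|->//].
by apply: hA => //; exact: hC.
Qed.

Lemma minimals_antichain A : antichain (minimals A).
Proof.
move=> x y; rewrite !inE => /andP[xA /forall_inP hx] /andP[yA /forall_inP hy].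
have nxy := hy x xA; have nyx := hx y yA.
by move=> xy; case: (comparable_ltgtP xy) nxy nyx.
Qed.

(** An element of [A] with the fewest elements of the poset below it is minimal
    in [A]. *)
Lemma minimals_neq0 A : A != set0 -> minimals A != set0.
Proof.
case/set0Pn => x0 x0A; apply/set0Pn.
case: (arg_minnP (fun x : P => #|[set z | (z <= x)%O]|) x0A) => m mA hm.
exists m; rewrite !inE; apply/andP; split=> //; apply/forall_inP => y yA.
apply/negP => ym; have := hm y yA; rewrite leqNgt => /negP; apply.
apply: proper_card; apply/properP; split.
  apply/subsetP => z; rewrite !inE => zy; exact: le_trans zy (ltW ym).
by exists m; rewrite !inE // lt_geF.
Qed.

(** If the least element of [C] is not minimal in [A], an element of [A] below
    it can be added to [C].  Consequently a longest chain in [A] always reaches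
    the minimal elements of [A]. *)
Lemma chain_extend_below A C : A != set0 -> is_chain C -> C \subset A ->
    [disjoint C & minimals A] ->
  exists D, [/\ is_chain D, D \subset A & #|D| = #|C|.+1].
Proof.
move=> A0 hC CA dCM; have [C0|] := eqVneq C set0.
  case/set0Pn: A0 => v vA; exists [set v]; split.
  - by rewrite -(setUid [set v]); apply: is_chain2; rewrite comparablexx.
  - by rewrite sub1set.
  - by rewrite cards1 C0 cards0.
move=> /minimals_neq0/set0Pn[m]; rewrite inE => /andP[mC /forall_inP m_min].
have mA := subsetP CA m mC.
have : m \notin minimals A by rewrite (disjointFr dCM).
rewrite inE mA /= negb_forall_in => /exists_inP[q qA /negPn qm].
have below z : z \in C -> (q < z)%O.
  move=> zC; apply: lt_le_trans qm _.
  have := m_min z zC.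
  by case: (comparable_ltgtP (is_chainP _ hC z m zC mC)) => // [/ltW|->].
exists (q |: C); split.
- apply/is_chainP => x y; rewrite !inE.
  move=> /orP[/eqP->|xC] /orP[/eqP->|yC]; first exact: comparablexx.
  + exact/lt_comparable/below.
  + by rewrite comparable_sym; apply/lt_comparable/below.
  + exact: (is_chainP _ hC).
- by rewrite subUset sub1set qA.
- rewrite cardsU1; case: (boolP (q \in C)) => // /below.
  by rewrite ltxx.
Qed.

(** [A] and [B] may overlap.  When they are antichains, a comparable pair is
    either an edge of their order graph or a common element, so the connected
    components of the graph satisfy this condition. *)
Definition separated A B K : Prop :=
  {in A & B, forall u v, (u >=< v)%O -> (u \in K) = (v \in K)}.

Definition swap A B K : {set P} := (A :\: K) :|: (B :&: K).

Lemma separated_sym A B K : separated A B K -> separated B A K.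
Proof. by move=> h u v uB vA uv; rewrite (h v u) // comparable_sym. Qed.

(** The only pairs that could spoil the antichain take one element from
    [A :\: K] and one from [B :&: K], and comparable elements of [A] and [B]
    are on the same side of [K]. *)
Lemma antichain_swap A B K : antichain A -> antichain B -> separated A B K ->
  antichain (swap A B K).
Proof.
move=> hA hB hK x y; rewrite !inE.
case/orP=> /andP[h1 h2] /orP[] /andP[h3 h4] xy.
- exact: hA.
- by have := hK x y h2 h3 xy; rewrite h4 (negbTE h1).
- by have := separated_sym hK h1 h4 xy; rewrite h2 (negbTE h3).
- exact: hB.
Qed.

(** The points of [pi] in [A] and in [B] are comparable, so both are in [K]
    or both are outside: the swap keeps one of them. *)
Lemma swap_meets A B K pi p q : is_chain pi -> separated A B K ->
    p \in A -> p \in pi -> q \in B -> q \in pi ->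
  exists2 r, r \in swap A B K & r \in pi.
Proof.
move=> /is_chainP hpi hK pA ppi qB qpi.
have pq := hK p q pA qB (hpi p q ppi qpi).
case: (boolP (p \in K)) => pK; last by exists p; rewrite // !inE pK pA.
by exists q; rewrite // !inE -pq pK qB orbT.
Qed.

End Chains.

(** * The cone of a path and its extreme rays *)

Section ConeTheory.
Context {R : realType} {d : Order.disp_t} {P : finPOrderType d}.
Local Notation V := {ffun P -> R^o}.
Local Notation ind := (@indicator R d P).
Implicit Types (w s a b : V) (pi A B C K : {set P}) (u v p q : P).

Lemma inner_sum w C : inner w (ind C) = \sum_(v in C) (w v : R).
Proof.
rewrite /inner [RHS]big_mkcond; apply: eq_bigr => v _.
by rewrite ffunE; case: (v \in C); rewrite ?mulr1 ?mulr0.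
Qed.

Lemma inner_lin (t1 t2 : R) w1 w2 (x : V) :
  inner (t1 *: w1 + t2 *: w2) x = t1 * inner w1 x + t2 * inner w2 x.
Proof.
rewrite /inner !mulr_sumr -big_split; apply: eq_bigr => v _.
by rewrite !ffunE mulrDl !mulrA.
Qed.

Lemma inner_indicator A C : inner (ind A) (ind C) = #|A :&: C|%:R.
Proof.
rewrite inner_sum -sum1_card natr_sum [RHS]big_mkcond [LHS]big_mkcond.
apply: eq_bigr => v _; rewrite in_setI ffunE.
by case: (v \in A); case: (v \in C).
Qed.

Lemma inner_supported s B C : B \subset C -> {in C :\: B, forall x, s x = 0} ->
  inner s (ind C) = \sum_(v in B) (s v : R).
Proof.
move=> BC s0; rewrite inner_sum (big_setID B) /= (setIidPr BC).
by rewrite [X in _ + X]big1 ?addr0.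
Qed.

Lemma supp_indicator A : supp (ind A) = A.
Proof.
by apply/setP => v; rewrite !inE ffunE; case: (v \in A);
  rewrite ?oner_neq0 ?eqxx.
Qed.

Lemma indicator_supp a : (forall v, a v = 0 \/ a v = 1) -> a = ind (supp a).
Proof.
move=> h; apply/ffunP => v; rewrite ffunE inE.
by case: (h v) => ->; rewrite ?eqxx ?oner_neq0.
Qed.

Lemma cone_lin pi (t1 t2 : R) w1 w2 : 0 <= t1 -> 0 <= t2 ->
  cone pi w1 -> cone pi w2 -> cone pi (t1 *: w1 + t2 *: w2).
Proof.
move=> t1p t2p [p1 m1] [p2 m2]; split=> [v|pi' hpi'].
  by rewrite !ffunE addr_ge0 // mulr_ge0.
by rewrite !inner_lin lerD // ler_wpM2l // ?m1 ?m2.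
Qed.

Lemma cone_add pi w1 w2 : cone pi w1 -> cone pi w2 -> cone pi (w1 + w2).
Proof. by rewrite -{2}[w1]scale1r -{2}[w2]scale1r; exact: cone_lin. Qed.

(** Every chain extends to a path, so for indicators the inequalities defining
    the cone say that [pi] contains a longest chain of [A]. *)
Lemma cone_indicatorP pi A :
  cone pi (ind A) <->
  (forall C, is_chain C -> C \subset A -> (#|C| <= #|A :&: pi|)%N).
Proof.
split=> [[_ h] C hC CA|h].
  have [pi' hpi' Cpi'] := chain_sub_path hC.
  have := h _ hpi'; rewrite !inner_indicator ler_nat; apply: leq_trans.
  by apply: subset_leq_card; rewrite subsetI CA.
split=> [v|pi' hpi']; first by rewrite ffunE ler0n.
rewrite !inner_indicator ler_nat; apply: h; last exact: subsetIl.
exact: sub_chain (subsetIr _ _) (path_chain hpi').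
Qed.

Lemma cone_antichain pi A p : antichain A -> p \in A -> p \in pi ->
  cone pi (ind A).
Proof.
move=> hA pA ppi; apply/cone_indicatorP => C /is_chainP hC /subsetP CA.
apply: (@leq_trans 1%N); last by apply/card_gt0P; exists p; rewrite inE pA.
apply/card_le1_eqP => x y xC yC.
by apply: hA; rewrite ?CA //; exact: hC.
Qed.

(** Split the support [A] of [a] into its minimal elements [M] and the rest.
    The chain [A :&: pi] is a longest one in [A], so it meets [M], and chains
    avoiding [M] are shorter.  Hence both pieces have their indicators in the
    cone, and extremality makes [ind M] proportional to [ind A]. *)
Lemma ER_antichain pi a : pi \in paths P -> ER pi a ->
  exists A p, [/\ a = ind A, antichain A, p \in A & p \in pi].
Proof.
move=> hpi [[ca a0 ext] /indicator_supp]; move: (supp a) => A aE.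
rewrite {}aE in ca a0 ext *.
have A0 : A != set0.
  apply: contraNneq a0 => ->; apply/eqP/ffunP => v; by rewrite !ffunE inE.
have longest C : is_chain C -> C \subset A -> [disjoint C & minimals A] ->
    (#|C| < #|A :&: pi|)%N.
  move=> hC CA dC; have [D [hD DA <-]] := chain_extend_below A0 hC CA dC.
  exact: (proj1 (cone_indicatorP _ _) ca).
have MA : minimals A \subset A by apply/subsetP => x; rewrite inE => /andP[].
have [p pM ppi] : exists2 p, p \in minimals A & p \in pi.
  have /negP : ~ [disjoint A :&: pi & minimals A].
    move=> dis; have := longest _ _ (subsetIl _ _) dis.
    by rewrite ltnn => /(_ (sub_chain (subsetIr _ _) (path_chain hpi))).
  rewrite -setI_eq0 => /set0Pn[p]; rewrite inE => /andP[].
  by rewrite inE => /andP[_ ppi] pM; exists p.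
have cM : cone pi (ind (minimals A)).
  exact: cone_antichain (@minimals_antichain _ _ A) pM ppi.
have cN : cone pi (ind (A :\: minimals A)).
  apply/cone_indicatorP => C hC; rewrite subsetD => /andP[CA dC].
  have := longest _ hC CA dC.
  rewrite -(cardsID (minimals A) (A :&: pi)) setIAC (setIidPr MA).
  rewrite (antichain_chain (@minimals_antichain _ _ A) (path_chain hpi) pM ppi).
  by rewrite cards1 add1n ltnS setIDAC.
have [|[t _ tE] _] := ext _ _ cM cN.
  exists 1 => //; rewrite scale1r; apply/ffunP => v; rewrite !ffunE in_setD.
  have := subsetP MA v.
  by case: (v \in minimals A) => [->|_]; rewrite ?addr0 ?add0r.
have t1 : t = 1.
  move/ffunP/(_ p): tE; rewrite !ffunE pM (subsetP MA _ pM).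
  by rewrite [RHS]mulr1 => <-.
have AM : A = minimals A.
  apply/setP => v; move/ffunP/(_ v): tE; rewrite !ffunE t1 scale1r => /eqP.
  by rewrite eqr_nat; case: (v \in A); case: (v \in minimals A).
exists A, p; split=> //; last exact: (subsetP MA).
by rewrite AM; exact: minimals_antichain.
Qed.

Lemma span2P a b s :
  reflect (exists t1 t2 : R, s = t1 *: a + t2 *: b) (s \in <<[:: a; b]>>%VS).
Proof.
rewrite span_cons span_seq1; apply: (iffP memv_addP).
  by move=> [_ /vlineP[t1 ->] [_ /vlineP[t2 ->] ->]]; exists t1, t2.
move=> [t1 [t2 ->]]; exists (t1 *: a); first by rewrite memvZ ?memv_line.
by exists (t2 *: b); rewrite // memvZ ?memv_line.
Qed.

Lemma span_perturbation pi a b s : cone pi a -> cone pi b ->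
  s \in <<[:: a; b]>>%VS -> perturbation pi (a + b) s.
Proof.
move=> ca cb /span2P[t1 [t2 ->]].
(* For the step [1 / (1 + |t1| + |t2|)] both coefficients [1 +- step * ti] are
   nonnegative; the extra 1 keeps the denominator positive. *)
have e0 : 0 < 1 + `|t1| + `|t2| by rewrite -addrA ltr_pwDl // addr_ge0.
exists (1 + `|t1| + `|t2|)^-1.
have bound (t : R) : `|t| <= 1 + `|t1| + `|t2| ->
    0 <= 1 + (1 + `|t1| + `|t2|)^-1 * t /\ 0 <= 1 - (1 + `|t1| + `|t2|)^-1 * t.
  move=> tb; have : `|(1 + `|t1| + `|t2|)^-1 * t| <= 1.
    by rewrite normrM gtr0_norm ?invr_gt0 // mulrC ler_pdivrMr ?mul1r.
  by rewrite ler_norml => /andP[h1 h2]; rewrite subr_ge0 -lerBlDl sub0r.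
have [|h1 h1'] := bound t1; first by rewrite -addrA addrCA lerDl addr_ge0.
have [|h2 h2'] := bound t2; first by rewrite lerDr addr_ge0.
split.
- by rewrite invr_gt0.
- rewrite scalerDr !scalerA addrACA -{1}[a]scale1r -{1}[b]scale1r -!scalerDl.
  exact: cone_lin.
- rewrite scalerDr !scalerA opprD addrACA -{1}[a]scale1r -{1}[b]scale1r.
  rewrite -!scalerBl; exact: cone_lin.
Qed.

Lemma perturbation_supp pi w s v : perturbation pi w s -> w v = 0 -> s v = 0.
Proof.
move=> [e [e0 [hp _] [hm _]]] wv.
have := hp v; have := hm v; rewrite !ffunE wv add0r add0r => h1 h2.
apply/eqP; rewrite eq_le -(pmulr_rge0 _ e0) -(pmulr_rle0 _ e0).
by rewrite -oppr_ge0 h1 h2.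
Qed.

Lemma perturbation_tight pi pi' w s : perturbation pi w s -> pi' \in paths P ->
  inner w (ind pi') = inner w (ind pi) ->
  inner s (ind pi') = inner s (ind pi).
Proof.
move=> [e [e0 [_ hp] [_ hm]]] hpi' tight.
have := hm _ hpi'; have := hp _ hpi'.
rewrite -scaleNr -[w]scale1r !inner_lin tight !lerD2l ler_pM2l // => h1.
rewrite !mulNr lerN2 ler_pM2l // => h2.
by apply/eqP; rewrite eq_le h1 h2.
Qed.

End ConeTheory.

(** * The order graph and the two-dimensional faces *)

Section OrderGraph.
Context {R : realType} {d : Order.disp_t} {P : finPOrderType d}.
Local Notation V := {ffun P -> R^o}.
Local Notation ind := (@indicator R d P).
Implicit Types (s : V) (pi A B K : {set P}) (u v p q : P).

Local Notation vertices A B := (order_graph_vertices (ind A) (ind B)).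
Local Notation edge A B := (order_graph_edge (ind A) (ind B)).

Definition order_graph A B : rel P := fun u v =>
  [&& u \in vertices A B, v \in vertices A B & edge A B u v].

Lemma in_vertices A B x :
  (x \in vertices A B) = (x \in A) (+) (x \in B).
Proof.
rewrite /order_graph_vertices !supp_indicator !inE.
by case: (x \in A); case: (x \in B).
Qed.

Lemma order_graphE A B u v : order_graph A B u v =
  [&& (u >=< v)%O, u \in vertices A B, v \in vertices A B
    & (u \in A) != (v \in A)].
Proof.
rewrite /order_graph !in_vertices /order_graph_edge /= !supp_indicator !inE.
by case: (u \in A); case: (u \in B); case: (v \in A); case: (v \in B);
  rewrite ?andbF ?andbT.
Qed.

Lemma order_graph_sym A B : symmetric (order_graph A B).
Proof.
move=> u v; rewrite !order_graphE comparable_sym eq_sym.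
by case: (_ >=< _)%O => //=; rewrite andbCA.
Qed.

(** The common value comes from [pi] itself, which is tight because it passes
    through [p] and [q].  The sum over [[set u; v]] covers the cases [u != v]
    and [u = v] at once. *)
Lemma perturbation_pair pi A B p q s :
    pi \in paths P -> antichain A -> antichain B ->
    p \in A -> p \in pi -> q \in B -> q \in pi ->
    perturbation pi (ind A + ind B) s ->
  {in A & B, forall u v, (u >=< v)%O ->
     \sum_(x in [set u; v]) (s x : R) = inner s (ind pi)}.
Proof.
move=> hpi hA hB pA ppi qB qpi ps u v uA vB uv.
have [pi' hpi'] := chain_sub_path (is_chain2 uv).
rewrite subUset !sub1set => /andP[upi' vpi'].
(* A path through a point of each antichain has the maximal weight 2. *)
have inner2 C x y : C \in paths P -> x \in A -> x \in C -> y \in B -> y \in C ->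
    inner (ind A + ind B) (ind C) = 1 + 1 :> R.
  move=> /path_chain hC xA xC yB yC.
  rewrite -[ind A]scale1r -[ind B]scale1r inner_lin !mul1r !inner_indicator.
  by rewrite (antichain_chain hA hC xA xC) (antichain_chain hB hC yB yC)
    !cards1.
rewrite -(perturbation_tight ps hpi').
  rewrite (inner_supported (B := [set u; v])) ?subUset ?sub1set ?upi' //.
  move=> x; rewrite !inE negb_or => /andP[/andP[xu xv] xpi'].
  apply: (perturbation_supp ps).
  have /setP/(_ x) := antichain_chain hA (path_chain hpi') uA upi'.
  have /setP/(_ x) := antichain_chain hB (path_chain hpi') vB vpi'.
  rewrite !inE xpi' !andbT (negbTE xu) (negbTE xv) => xB xA.
  by rewrite !ffunE xA xB addr0.
by rewrite (inner2 pi' u v) // (inner2 pi p q).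
Qed.

(** Replacing [s x] by [c - s x] for [x] outside [A] turns the edge condition
    [s u + s v = c] into equality, so the resulting function is constant on the
    vertices of the connected graph. *)
Lemma connected_span A B (c : R) s :
    {in A & B, forall u v, (u >=< v)%O ->
       \sum_(x in [set u; v]) (s x : R) = c} ->
    (forall v, v \notin A -> v \notin B -> s v = 0) ->
    order_graph_connected (ind A) (ind B) ->
  s \in <<[:: ind A; ind B]>>%VS.
Proof.
move=> sum_c s0 con.
pose h x : R := if x \in A then s x else c - s x.
have h_edge u v : order_graph A B u v -> h u = h v.
  wlog uA : u v / u \in A => [wl|].
    move=> guv; case: (boolP (u \in A)) => uA; first exact: wl.
    apply/esym/wl; last by rewrite order_graph_sym.
    move: guv; rewrite order_graphE (negbTE uA) => /and4P[_ _ _].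
    by case: (v \in A).
  rewrite order_graphE !in_vertices /h uA => /and4P[uv _].
  have [//|vA /= vB _] := boolP (v \in A).
  rewrite -(sum_c u v uA vB uv) big_setU1 ?big_set1 ?addrK // inE.
  by apply: contraNneq vA => <-.
have h_const x y : connect (order_graph A B) x y -> h x = h y.
  have cl : closed (order_graph A B) [pred z | h z == h x].
    by move=> u v /h_edge uv; rewrite !inE uv.
  by move=> /(closed_connect cl); rewrite !inE eqxx => /esym/eqP.
(* If [A = B] the graph has no vertices, and any [t] will do. *)
have [t ht] : exists t, forall x, x \in vertices A B -> h x = t.
  have [->|[x0 x0V]] := set_0Vmem (vertices A B).
    by exists 0 => x; rewrite inE.
  by exists (h x0) => x xV; apply: h_const; exact: con.
apply/span2P; exists t, (c - t); apply/ffunP => x; rewrite !ffunE.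
have := ht x; rewrite in_vertices /h.
case: (boolP (x \in A)) => xA; case: (boolP (x \in B)) => xB hx.
- have := sum_c x x xA xB (comparablexx _); rewrite setUid big_set1 => ->.
  by rewrite ![_ *: 1]mulr1 addrC subrK.
- by rewrite hx // scaler0 addr0 [RHS]mulr1.
- by rewrite -hx // scaler0 add0r [RHS]mulr1 subKr.
- by rewrite s0 // !scaler0 addr0.
Qed.

Lemma swap_add A B K : ind (swap A B K) + ind (swap B A K) = ind A + ind B.
Proof.
apply/ffunP => v; rewrite !ffunE !inE.
by case: (v \in A); case: (v \in B); case: (v \in K); rewrite /= ?addr0 ?add0r.
Qed.

(** With step 1, moving along [ind (swap A B K) - ind A] gives
    [ind (swap A B K) + ind B], and moving back gives
    [ind A + ind (swap B A K)]. *)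
Lemma swap_perturbation pi A B K p q :
    is_chain pi -> antichain A -> antichain B ->
    p \in A -> p \in pi -> q \in B -> q \in pi -> separated A B K ->
  perturbation pi (ind A + ind B) (ind (swap A B K) - ind A).
Proof.
move=> hpi hA hB pA ppi qB qpi hK; have hK' := separated_sym hK.
have [r rS rpi] := swap_meets hpi hK pA ppi qB qpi.
have [r' rS' rpi'] := swap_meets hpi hK' qB qpi pA ppi.
have cA := cone_antichain (R := R) hA pA ppi.
have cB := cone_antichain (R := R) hB qB qpi.
have cS := cone_antichain (R := R) (antichain_swap hA hB hK) rS rpi.
have cS' := cone_antichain (R := R) (antichain_swap hB hA hK') rS' rpi'.
exists 1; rewrite !scale1r; split; first exact: ltr01.
  by rewrite [ind A + _]addrC addrACA subrr addr0; exact: cone_add.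
rewrite opprB -{1}(swap_add A B K) addrC addrA subrK; exact: cone_add.
Qed.

(** Suppose [x] and [y] are in different components, let [K] be the component
    of [x], and write [ind (swap A B K)] as [t *: ind A + t' *: ind B].
    Weighing both sides along [pi] gives [t + t' = 1].  Evaluating at a vertex
    gives [t] or [t'], whence [t = 0] at [x], which is in [K], and [t = 1] at
    [y], which is not. *)
Lemma connected_of_2face pi A B p q :
    is_chain pi -> antichain A -> antichain B ->
    p \in A -> p \in pi -> q \in B -> q \in pi ->
    form_2face pi (ind A) (ind B) ->
  order_graph_connected (ind A) (ind B).
Proof.
move=> hpi hA hB pA ppi qB qpi face x y xV yV; apply: contraT => nxy.
pose K := [set z | connect (order_graph A B) x z].
have cK : connect_sym (order_graph A B)
  by exact/sym_connect_sym/order_graph_sym.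
have hK : separated A B K.
  move=> u v uA vB uv; rewrite !inE.
  have [vA|vA] := boolP (v \in A); first by rewrite (hA u v).
  have [uB|uB] := boolP (u \in B); first by rewrite (hB u v).
  apply: same_connect_r => //; apply: connect1.
  by rewrite order_graphE uv !in_vertices uA vB (negbTE uB) (negbTE vA).
have /face/span2P[t1 [t2 swE]] := swap_perturbation hpi hA hB pA ppi qB qpi hK.
have {}swE : ind (swap A B K) = (t1 + 1) *: ind A + t2 *: ind B.
  by rewrite scalerDl scale1r addrAC -swE subrK.
have [r rS rpi] := swap_meets hpi hK pA ppi qB qpi.
have sum1 : t1 + 1 + t2 = 1.
  have := congr1 (inner^~ (ind pi)) swE; rewrite /= inner_lin !inner_indicator.
  rewrite (antichain_chain (antichain_swap hA hB hK) hpi rS rpi).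
  rewrite (antichain_chain hA hpi pA ppi) (antichain_chain hB hpi qB qpi).
  by rewrite !cards1 !mulr1.
have t12 z : z \in vertices A B -> t1 + 1 = (z \notin K)%:R.
  rewrite in_vertices; move/ffunP/(_ z): swE.
  rewrite !ffunE in_setU in_setD in_setI.
  case: (z \in A); case: (z \in B); case: (z \in K) => //=.
  - by rewrite scaler0 addr0 [RHS]mulr1.
  - by rewrite scaler0 addr0 [RHS]mulr1.
  - rewrite scaler0 add0r [X in _ = X]mulr1 => t2E _.
    by apply: (addIr t2); rewrite sum1 -t2E add0r.
  - rewrite scaler0 add0r [X in _ = X]mulr1 => t2E _.
    by apply: (addIr t2); rewrite sum1 -t2E addr0.
have := t12 y yV; rewrite (t12 x xV) !inE connect0 (negbTE nxy) /= => /eqP.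
by rewrite eq_sym oner_eq0.
Qed.

End OrderGraph.

Theorem theorem4p2 (R : realType) (d : Order.disp_t) (P : finPOrderType d)
    (P_connected : poset_connected P)
    (pi : {set P}) (pi_path : pi \in paths P)
    (a1 a2 : {ffun P -> R^o})
    (a1_ER : ER pi a1) (a2_ER : ER pi a2) (a1_neq_a2 : a1 <> a2) :
  form_2face pi a1 a2 <-> order_graph_connected a1 a2.
Proof.
have [A [p [-> hA pA ppi]]] := ER_antichain pi_path a1_ER.
have [B [q [-> hB qB qpi]]] := ER_antichain pi_path a2_ER.
split=> [|con s].
  exact: connected_of_2face (path_chain pi_path) hA hB pA ppi qB qpi.
split=> [ps|]; last first.
  by apply: span_perturbation;
    [exact: cone_antichain ppi | exact: cone_antichain qpi].
apply: connected_span con.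
  exact: perturbation_pair pi_path hA hB pA ppi qB qpi ps.
move=> v vA vB; apply: (perturbation_supp ps).
by rewrite !ffunE (negbTE vA) (negbTE vB) addr0.
Qed.
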